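(* Let $P$ be a finite poset of width $n>2$, and let $L=\mathcal{J}(P)$. Then the defining ideal of the chain algebra $K[\mathcal{C}_L]$ has a minimal generator of degree $n$.
   Context: All posets are finite. The width of a poset is the number of elements in its largest antichain. An ideal of $P$ is a downward closed subset, and $\mathcal{J}(P)$ is the finite distributive lattice of all ideals of $P$ ordered by inclusion. Label the elements of $L$ as variables $t_1,\ldots,t_s$ over a field $K$. To a maximal chain $C$ of $L$ associate the monomial $t_C=\prod_{t_i\in C}t_i$. The chain algebra $K[\mathcal{C}_L]$ is the $K$-subalgebra of $K[t_1,\ldots,t_s]$ generated by all $t_C$, $C$ a maximal chain of $L$. Its defining ideal is the kernel $I$ of the surjective $K$-algebra homomorphism $K[T_C\mid C \text{ a maximal chain of }L]\to K[\mathcal{C}_L]$, $T_C\mapsto t_C$; it is homogeneous with respect to the standard grading $\deg T_C=1$. Having a minimal generator of degree $n$ means that a minimal homogeneous generating set of $I$ contains an element of degree $n$ (equivalently, $I$ contains a homogeneous element of degree $n$ not in the ideal generated by the elements of $I$ of degree $<n$). *)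

(* Defs.v *)
From HB Require Import structures.
From mathcomp Require Import all_boot all_order all_algebra.
From mathcomp Require Import mpoly.

Set Implicit Arguments.
Unset Strict Implicit.
Unset Printing Implicit Defensive.

Import Order.TTheory GRing.Theory.

Section Posets.
Local Open Scope order_scope.
Context {d : Order.disp_t}.
Implicit Types (P : finPOrderType d).

Definition is_antichain P (A : {set P}) : bool :=
  [forall x in A, forall y in A, (x >=< y) ==> (x == y)].

Definition width P : nat := \max_(A : {set P} | is_antichain A) #|A|.

Definition is_chain P (C : {set P}) : bool :=
  [forall x in C, forall y in C, x >=< y].

Definition is_ideal P (A : {set P}) : bool :=
  [forall x in A, forall y, (y <= x) ==> (y \in A)].

Record ideals P := Ideals { ideal_set :> {set P}; _ : is_ideal ideal_set }.

Record max_chain P :=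
  MaxChain { chain_set :> {set P}; _ : maxset (@is_chain P) chain_set }.

End Posets.

HB.instance Definition _ d (P : finPOrderType d) :=
  [isSub for @ideal_set d P].
HB.instance Definition _ d (P : finPOrderType d) :=
  [Finite of ideals P by <:].
HB.instance Definition _ d (P : finPOrderType d) :=
  [isSub for @chain_set d P].
HB.instance Definition _ d (P : finPOrderType d) :=
  [Finite of max_chain P by <:].

Section IdealLattice.
Local Open Scope order_scope.
Context {d : Order.disp_t} (P : finPOrderType d).
Implicit Types A B C : ideals P.

Lemma is_idealP (A : {set P}) :
  reflect (forall x y, x \in A -> y <= x -> y \in A) (is_ideal A).
Proof.
apply: (iffP forall_inP) => [h x y /h /forallP /(_ y) /implyP //|h x xA].
by apply/forallP => y; apply/implyP; apply: h.
Qed.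

Lemma ideal_closed A x y : x \in (A : {set P}) -> y <= x -> y \in (A : {set P}).
Proof. by case: A => A /= /is_idealP; apply. Qed.

Fact ideal_meet_subproof A B : is_ideal (A :&: B).
Proof.
apply/is_idealP => x y; rewrite !in_setI => /andP[xA xB] yx.
by rewrite !(ideal_closed _ yx).
Qed.

Fact ideal_join_subproof A B : is_ideal (A :|: B).
Proof.
apply/is_idealP => x y; rewrite !in_setU => /orP[xA|xB] yx.
  by rewrite (ideal_closed xA yx).
by rewrite (ideal_closed xB yx) orbT.
Qed.

Definition ideal_le A B : bool := (A : {set P}) \subset B.
Definition ideal_meet A B : ideals P := Ideals (ideal_meet_subproof A B).
Definition ideal_join A B : ideals P := Ideals (ideal_join_subproof A B).

Fact ideal_leEmeet A B : ideal_le A B = (ideal_meet A B == A).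
Proof. by apply/setIidPl/eqP => [AB|/(congr1 val)//]; apply: val_inj. Qed.

Fact ideal_meetC : commutative ideal_meet.
Proof. by move=> A B; apply: val_inj; apply: setIC. Qed.

Fact ideal_joinC : commutative ideal_join.
Proof. by move=> A B; apply: val_inj; apply: setUC. Qed.

Fact ideal_meetA : associative ideal_meet.
Proof. by move=> A B C; apply: val_inj; apply: setIA. Qed.

Fact ideal_joinA : associative ideal_join.
Proof. by move=> A B C; apply: val_inj; apply: setUA. Qed.

Fact ideal_joinKI B A : ideal_meet A (ideal_join A B) = A.
Proof. by apply: val_inj; rewrite /= setIC setUK. Qed.

Fact ideal_meetKU B A : ideal_join A (ideal_meet A B) = A.
Proof. by apply: val_inj; rewrite /= setUC setIK. Qed.

Fact ideal_meetUl : left_distributive ideal_meet ideal_join.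
Proof. by move=> A B C; apply: val_inj; apply: setIUl. Qed.

Fact ideal_meetxx : idempotent_op ideal_meet.
Proof. by move=> A; apply: val_inj; apply: setIid. Qed.

Fact ideal_display : Order.disp_t. Proof. exact: Order.Disp tt tt. Qed.

HB.instance Definition _ :=
  Order.isMeetJoinDistrLattice.Build ideal_display (ideals P)
    ideal_leEmeet (fun _ _ => erefl) ideal_meetC ideal_joinC
    ideal_meetA ideal_joinA ideal_joinKI ideal_meetKU ideal_meetUl ideal_meetxx.

End IdealLattice.

Section GradedIdeals.
Local Open Scope ring_scope.
Context {n : nat} {R : comNzRingType}.
Implicit Types (G I : {mpoly R[n]} -> Prop) (f g : {mpoly R[n]}).

Definition in_generated_ideal G f : Prop :=
  exists (m : nat) (a g : 'I_m -> {mpoly R[n]}),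
    (forall i, G (g i)) /\ f = \sum_(i < m) a i * g i.

Definition generates G I : Prop := forall f, I f <-> in_generated_ideal G f.

Definition homogeneous_generating_set G I : Prop :=
  generates G I /\ (forall g, G g -> exists e : nat, g \is e.-homog).

Definition minimal_homogeneous_generating_set G I : Prop :=
  homogeneous_generating_set G I /\
  (forall G' : {mpoly R[n]} -> Prop,
     (forall g, G' g -> G g) -> generates G' I -> forall g, G g -> G' g).

(* [g != 0] is needed for [e] to be the degree of [g], since 0 is
   [e.-homog] for every [e]. *)
Definition has_minimal_generator_of_degree (e : nat) I : Prop :=
  exists G, minimal_homogeneous_generating_set G I /\
    exists g, [/\ G g, g != 0 & g \is e.-homog].

Definition in_generated_subalgebra G f : Prop :=
  forall S : {mpoly R[n]} -> Prop,
    (forall c : R, S c%:MP) ->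
    (forall g h, S g -> S h -> S (g + h)) ->
    (forall g h, S g -> S h -> S (g * h)) ->
    (forall g, G g -> S g) -> S f.

End GradedIdeals.

Section ChainAlgebra.
Local Open Scope ring_scope.
Context (K : fieldType) {d : Order.disp_t} (L : finPOrderType d).

(* The variable t_x is ['X_(enum_rank x)], and T_C is ['X_(enum_rank C)]. *)
Definition chain_monomial (C : max_chain L) : {mpoly K[#|L|]} :=
  \prod_(x in (C : {set L})) 'X_(enum_rank x).

Definition chain_algebra : {mpoly K[#|L|]} -> Prop :=
  in_generated_subalgebra (fun q => exists C : max_chain L, q = chain_monomial C).

Definition chain_map (f : {mpoly K[#|{: max_chain L}|]}) : {mpoly K[#|L|]} :=
  f \mPo [tuple chain_monomial (enum_val i) | i < #|{: max_chain L}|].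

Lemma chain_mapX (C : max_chain L) :
  chain_map 'X_(enum_rank C) = chain_monomial C.
Proof.
by rewrite /chain_map comp_mpolyXU -tnth_nth tnth_mktuple enum_rankK.
Qed.

Lemma chain_algebraP (q : {mpoly K[#|L|]}) :
  chain_algebra q <-> exists f, q = chain_map f.
Proof.
split=> [h|[f ->] S SC SD SM SG].
  apply: (h (fun q => exists f, q = chain_map f)).
  - by move=> c; exists c%:MP; rewrite /chain_map comp_mpolyC.
  - by move=> _ _ [f ->] [g ->]; exists (f + g); rewrite /chain_map comp_mpolyD.
  - by move=> _ _ [f ->] [g ->]; exists (f * g); rewrite /chain_map rmorphM.
  - by move=> _ [C ->]; exists 'X_(enum_rank C); rewrite chain_mapX.
rewrite /chain_map comp_mpolyEX.
have S0 : S 0 by rewrite -mpolyC0; apply: (SC).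
have S1 : S 1 by rewrite -mpolyC1; apply: (SC).
apply: (big_ind S S0 SD) => m _; rewrite comp_mpolyX -mul_mpolyC; apply: (SM) => //.
apply: (big_ind S S1 SM) => i _; rewrite tnth_mktuple.
elim: (m i) => [|k IHk]; first by rewrite expr0.
by rewrite exprS; apply: (SM) => //; apply: (SG); exists (enum_val i).
Qed.

(* By [chain_algebraP], [chain_map] is the presentation of the chain algebra. *)
Definition chain_defining_ideal : {mpoly K[#|{: max_chain L}|]} -> Prop :=
  fun f => chain_map f = 0.

End ChainAlgebra.

(* Main.v *)
Require Import Defs.
From mathcomp Require Import all_boot all_order all_algebra.
From mathcomp Require Import mpoly.
From mathcomp Require Import zify.
From Stdlib Require Import ClassicalEpsilon.

Set Implicit Arguments.
Unset Strict Implicit.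
Unset Printing Implicit Defensive.

Import Order.TTheory GRing.Theory.

(** Let [a] enumerate an antichain of size [n] of [P].  The ideals [cube a B]
    between the ideal strictly below the antichain and the ideal it generates
    form a Boolean lattice of rank [n].  Inside it, index the antichain by the
    integers modulo [n] and take the cyclic intervals.  For each [i] the
    intervals {i}, {i, i+1}, {i, i+1, i+2}, ... form a chain, and completing
    all of them by one common chain below and one common chain above the cube
    gives [n] maximal chains C_0, ..., C_(n-1).  Replacing, in C_i, every
    interval of length at least 2 by the one starting at i-1 gives maximal
    chains D_0, ..., D_(n-1).  Each family passes exactly once through every
    proper nonempty cyclic interval, so the binomial
    T_(C_0) ... T_(C_(n-1)) - T_(D_0) ... T_(D_(n-1)) is in the defining ideal.
    Here [n > 2] makes the two families different.

    This binomial is not generated in lower degrees.  The reason is that a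
    proper subfamily of the C_i is determined by the multiset of lattice
    elements that it visits ([unique_fibre]).  Indeed, cut the cycle at an index
    which the subfamily misses and follow any family with the same content up
    the levels: a chain at the interval of start i moves to the interval of
    start i or i-1, and by induction on i from the cut the start i-1 is already
    taken, so every chain keeps its start.  Hence every element of the
    defining ideal has coefficient 0 at a proper divisor of the product of the
    T_(C_i) ([mcoeff_chain_map_inj]), and no combination of elements of degree
    less than [n] reaches that product itself
    ([cyclic_binomial_indecomposable]).

    It remains to pass from an indecomposable element of degree [n] to a minimal
    generating set ([minimal_generator_criterion]).  In each degree one chooses
    a basis of the homogeneous elements of the ideal modulo the decomposable
    ones; the union of these bases is a minimal generating set, and its part of
    degree [n] is nonempty as soon as some element of degree [n] is
    indecomposable.  The defining ideal is homogeneous because every maximal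
    chain contains the empty ideal, so that the exponent of the corresponding
    variable in the image of a monomial is the degree of the monomial. *)

(** * Ideals generated by a predicate *)

Section GeneratedIdeal.
Local Open Scope ring_scope.
Context {n : nat} {R : comNzRingType}.
Implicit Types (G : {mpoly R[n]} -> Prop) (f g : {mpoly R[n]}).

Lemma gen_ideal_incl G g : G g -> in_generated_ideal G g.
Proof.
by move=> Gg; exists 1, (fun=> 1), (fun=> g); split=> //; rewrite big_ord1 mul1r.
Qed.

Lemma gen_ideal0 G : in_generated_ideal G 0.
Proof.
by exists 0, (fun=> 0), (fun=> 0); split=> [[] // | ]; rewrite big_ord0.
Qed.

Lemma gen_idealD G f g :
  in_generated_ideal G f -> in_generated_ideal G g -> in_generated_ideal G (f + g).
Proof.
move=> [m1 [a1 [g1 [G1 ->]]]] [m2 [a2 [g2 [G2 ->]]]].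
exists (m1 + m2)%N, (fun i => match split i with inl j => a1 j | inr j => a2 j end),
  (fun i => match split i with inl j => g1 j | inr j => g2 j end).
split=> [i|]; first by case: (split i).
rewrite big_split_ord; congr (_ + _); apply: eq_bigr => i _.
  by rewrite (unsplitK (inl i)).
by rewrite (unsplitK (inr i)).
Qed.

Lemma gen_idealM G a f : in_generated_ideal G f -> in_generated_ideal G (a * f).
Proof.
move=> [m [b [g [Gg ->]]]]; exists m, (fun i => a * b i), g; split=> //.
by rewrite mulr_sumr; apply: eq_bigr => i _; rewrite mulrA.
Qed.

Lemma gen_ideal_sum G (J : Type) (r : seq J) (F : J -> {mpoly R[n]}) :
  (forall i, in_generated_ideal G (F i)) -> in_generated_ideal G (\sum_(i <- r) F i).
Proof. by move=> h; elim/big_ind: _ => //; [exact: gen_ideal0|exact: gen_idealD]. Qed.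

Lemma gen_ideal_trans G H f : (forall g, G g -> in_generated_ideal H g) ->
  in_generated_ideal G f -> in_generated_ideal H f.
Proof.
move=> h [m [a [g [Gg ->]]]]; apply: gen_ideal_sum => i.
by apply: gen_idealM; apply: h.
Qed.

(** Multiplication by a form of degree [d] shifts the grading by [d]. *)
Lemma pihomogMr a g d e : g \is d.-homog ->
  pihomog mdeg e (a * g) = (if (d <= e)%N then pihomog mdeg (e - d) a * g else 0).
Proof.
move=> hg; set k := maxn (mmeasure mdeg a) e.+1.
rewrite {1}(pihomog_partitionE (leq_maxl _ _ : (mmeasure mdeg a <= k)%N)).
rewrite mulr_suml raddf_sum /=.
case: leqP => de; last first.
  rewrite big1 // => i _; apply: (@pihomog_ne0 _ _ _ (i + d)%N).
    by apply/eqP; lia.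
  by apply: dhomogM => //; apply: pihomogP.
have lt_k : (e - d < k)%N by rewrite /k leq_max; apply/orP; right; lia.
rewrite (bigD1 (Ordinal lt_k)) //= big1 ?addr0 => [|i /eqP ne].
  rewrite pihomog_dE // -[X in _ \is X.-homog](subnK de).
  by apply: dhomogM => //; apply: pihomogP.
apply: (@pihomog_ne0 _ _ _ (i + d)%N).
  by apply/eqP => E; apply: ne; apply: val_inj => /=; lia.
by apply: dhomogM => //; apply: pihomogP.
Qed.

End GeneratedIdeal.

(** * Linear independence modulo a subspace *)

Section IndependentModulo.
Local Open Scope ring_scope.
Context {K : fieldType} {V : lmodType K}.
Implicit Types (S W : V -> Prop) (X : seq V).

Definition independent_mod W X : Prop :=
  uniq X /\ forall c : V -> K, W (\sum_(x <- X) c x *: x) ->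
    forall x, x \in X -> c x = 0.

Definition spanned_mod W X v : Prop :=
  exists c : V -> K, W (v - \sum_(x <- X) c x *: x).

Context (W : V -> Prop) (W0 : W 0)
  (WD : forall v w, W v -> W w -> W (v + w))
  (WZ : forall (a : K) v, W v -> W (a *: v)).

(** If a combination of [v :: X] lies in [W] with a nonzero coefficient at [v],
    dividing by it expresses [v] through [X] modulo [W]. *)
Lemma independent_mod_cons X v :
  independent_mod W X -> ~ spanned_mod W X v -> independent_mod W (v :: X).
Proof.
move=> [uX iX] nv; have vX : v \notin X.
  apply/negP => vX; apply: nv; exists (fun x => (x == v)%:R).
  rewrite (bigD1_seq v) //= eqxx scale1r big1 ?addr0 ?subrr //.
  by move=> x /negPf ->; rewrite scale0r.
split=> [|c]; first by rewrite /= vX.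
rewrite big_cons => Wc.
have cv0 : c v = 0.
  apply/eqP/negP => /negP cv; apply: nv; exists (fun x => - (c v)^-1 * c x).
  have := WZ (c v)^-1 Wc; rewrite scalerDr scalerA mulVf // scale1r scaler_sumr.
  rewrite -sumrN; congr (W (_ + _)); apply: eq_bigr => x _.
  by rewrite mulNr scaleNr opprK scalerA.
move=> x; rewrite inE => /predU1P[-> //|xX]; apply: iX => //.
by move: Wc; rewrite cv0 scale0r add0r.
Qed.

(** The bound [D] replaces finite dimension: adding to an independent list a
    vector that it does not span keeps it independent, so this process stops,
    and it only stops at a spanning list. *)
Lemma spanning_independent_mod S (D : nat) :
    (forall X, {in X, forall x, S x} -> independent_mod W X -> (size X <= D)%N) ->
  exists X, [/\ {in X, forall x, S x}, independent_mod W X &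
    forall v, S v -> spanned_mod W X v].
Proof.
move=> bnd.
suff: forall k X, (D - size X <= k)%N -> {in X, forall x, S x} ->
    independent_mod W X ->
    exists Y, [/\ {in Y, forall x, S x}, independent_mod W Y &
    forall v, S v -> spanned_mod W Y v].
  by move=> /(_ D [::]); apply; [exact: leq_subr | by [] | split].
move=> k; elim: k => [|k IHk] X le_k SX iX;
  (case: (classic (exists2 v, S v & ~ spanned_mod W X v))
    => [[v Sv nv]|spX]; last first).
- by exists X; split=> // v Sv; apply: NNPP => nv; apply: spX; exists v.
- have SvX : {in v :: X, forall x, S x} by move=> x; rewrite inE => /predU1P[->|/SX].
  by have /= := bnd _ SvX (independent_mod_cons iX nv); lia.
- by exists X; split=> // v Sv; apply: NNPP => nv; apply: spX; exists v.
have SvX : {in v :: X, forall x, S x} by move=> x; rewrite inE => /predU1P[->|/SX].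
have ivX := independent_mod_cons iX nv; have /= := bnd _ SvX ivX => lt_D.
by apply: (IHk (v :: X)) => //=; lia.
Qed.

End IndependentModulo.

(** * Minimal generators of a homogeneous ideal *)

Section MinimalGenerators.
Local Open Scope ring_scope.
Context {n : nat} {K : fieldType}.
Implicit Types (X : seq {mpoly K[n]}) (f g : {mpoly K[n]}).

(** A list longer than the number of monomials of degree at most [e] has a
    linearly dependent matrix of coefficients. *)
Lemma size_independent_homog (W : {mpoly K[n]} -> Prop) (W0 : W 0) e X :
    {in X, forall x, x \is e.-homog} -> independent_mod W X ->
  (size X <= #|{: 'X_{1..n < e.+1}}|)%N.
Proof.
move=> homX [uX iX]; rewrite leqNgt; apply/negP => lt_X.
pose M := \matrix_(i < size X, j < #|{: 'X_{1..n < e.+1}}|)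
  (X`_i)@_(enum_val j : 'X_{1..n < e.+1}).
have : kermx M != 0.
  rewrite kermx_eq0 -row_leq_rank -ltnNge.
  by apply: leq_ltn_trans lt_X; apply: rank_leq_col.
case/rowV0Pn => v /sub_kermxP vM /eqP v0; apply: v0.
(* Independence is stated with coefficients indexed by vectors, so the kernel
   vector [v] is transported along the positions in the uniq list [X]. *)
pose c x := if insub (index x X) is Some i then v 0 i else 0.
have cE (i : 'I_(size X)) : c X`_i = v 0 i.
  by rewrite /c index_uniq // valK.
apply/rowP => i; rewrite mxE -cE; apply: iX; last exact: mem_nth.
suff -> : \sum_(x <- X) c x *: x = 0 by [].
rewrite (big_nth 0) big_mkord; apply/mpolyP => m; rewrite mcoeff0.
have [mE|mE] := eqVneq (mdeg m) e; last first.
  rewrite raddf_sum big1 // => j _ /=; rewrite mcoeffZ (dhomog_nemf_coeff _ mE) ?mulr0 //.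
  by apply: homX; exact: mem_nth.
have ltm : (mdeg m < e.+1)%N by rewrite mE.
have /rowP/(_ (enum_rank (BMultinom ltm))) := vM; rewrite !mxE => <-.
rewrite raddf_sum; apply: eq_bigr => j _ /=.
by rewrite mcoeffZ cE mxE enum_rankK.
Qed.

Variables (I : {mpoly K[n]} -> Prop).
Hypotheses (I0 : I 0) (ID : forall f g, I f -> I g -> I (f + g))
  (IM : forall a f, I f -> I (a * f))
  (Ihomog : forall e f, I f -> I (pihomog mdeg e f)).

Definition below (e : nat) (f : {mpoly K[n]}) : Prop :=
  I f /\ exists2 k, (k < e)%N & f \is k.-homog.

Definition decomposable e := in_generated_ideal (below e).

Lemma ideal_of_gen (G : {mpoly K[n]} -> Prop) f :
  (forall g, G g -> I g) -> in_generated_ideal G f -> I f.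
Proof.
by move=> GI [m [a [g [Gg ->]]]]; elim/big_ind: _ => // i _; apply/IM/GI.
Qed.

Let decomposableZ e (a : K) f : decomposable e f -> decomposable e (a *: f).
Proof. by rewrite -mul_mpolyC; apply: gen_idealM. Qed.

Lemma degree_basis e : exists X, [/\ {in X, forall x, I x /\ x \is e.-homog},
  independent_mod (decomposable e) X &
  forall f, I f /\ f \is e.-homog -> spanned_mod (decomposable e) X f].
Proof.
apply: (spanning_independent_mod (gen_ideal0 _) (@decomposableZ e)).
move=> X hX; apply: (size_independent_homog (gen_ideal0 _) (e := e)).
by move=> x /hX[].
Qed.

(** In degree [k] of a relation between the chosen generators, those of lower
    degree contribute decomposable elements, those of higher degree nothing, and
    those of degree [k] only scalar multiples of themselves.  A generator of
    degree [k] that was a combination of the others would thus violate the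
    independence modulo decomposable elements in degree [k]. *)
Lemma minimal_generator_criterion e g0 :
    I g0 -> g0 \is e.-homog -> ~ decomposable e g0 ->
  has_minimal_generator_of_degree e I.
Proof.
move=> Ig0 hg0 ng0.
have [X XP] : exists X : nat -> seq {mpoly K[n]}, forall k,
    [/\ {in X k, forall x, I x /\ x \is k.-homog},
    independent_mod (decomposable k) (X k) &
    forall f, I f /\ f \is k.-homog -> spanned_mod (decomposable k) (X k) f].
  pose B k := constructive_indefinite_description _ (degree_basis k).
  by exists (fun k => proj1_sig (B k)) => k; apply: (proj2_sig (B k)).
pose G g := exists k, g \in X k.
have GI g : G g -> I g by move=> [k /(let: And3 h _ _ := XP k in h)[]].
have genI : generates G I.
  move=> f; split; last exact: ideal_of_gen.
  have homI k : forall g, I g -> g \is k.-homog -> in_generated_ideal G g.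
    elim/ltn_ind: k => k IHk g Ig hg; have [_ _ /(_ g (conj Ig hg))[c]] := XP k.
    set s := \sum_(x <- _) _ => dec.
    rewrite -(subrK s g); apply: gen_idealD.
      by apply: gen_ideal_trans dec => h [Ih [j jk hj]]; apply: (IHk j).
    rewrite /s big_seq; elim/big_ind: _ => [|? ?|x xX]; first exact: gen_ideal0.
      exact: gen_idealD.
    by rewrite -mul_mpolyC; apply/gen_idealM/gen_ideal_incl; exists k.
  move=> If; rewrite (pihomog_partitionE (leqnn (mmeasure mdeg f))).
  by apply: gen_ideal_sum => k; apply: (homI k); [exact: Ihomog | exact: pihomogP].
exists G; split; last first.
  have [hX [uX iX] spX] := XP e; case EX: (X e) => [|x s].
    have [c] := spX g0 (conj Ig0 hg0).
    by rewrite EX big_nil subr0.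
  have xX : x \in X e by rewrite EX mem_head.
  exists x; split; [by exists e | | by case: (hX x xX)].
  apply/eqP => x0; have : decomposable e (\sum_(y <- X e) (y == x)%:R *: y).
    rewrite big1 => [|y _]; first exact: gen_ideal0.
    by case: eqVneq => [->|_]; rewrite ?x0 ?scaler0 ?scale0r.
  by move/iX => /(_ x xX) /eqP; rewrite eqxx oner_eq0.
split.
  split=> // g [k gX]; exists k.
  by have [/(_ _ gX)[]] := XP k.
move=> G' G'G gen' g [k gX]; apply: NNPP => nG'g.
have [hX [uX iX] _] := XP k; have [Ig hg] := hX g gX.
have [m [a [h [G'h gE]]]] := (gen' g).1 Ig.
(* [b i] is the constant term of [a i] when [h i] has degree [k], the only case
   in which [a i * h i] contributes an indecomposable part in degree [k]. *)
pose b i := if h i \in X k then (pihomog mdeg 0 (a i))@_0%MM else 0 : K.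
have part i : decomposable k (pihomog mdeg k (a i * h i) - b i *: h i).
  have [j hj] := G'G _ (G'h i); have [/(_ _ hj)[Ih hh] _ _] := XP j.
  rewrite (pihomogMr _ _ hh) /b; case: (ltngtP j k) => jk.
  - have dh : decomposable k (h i) by apply: gen_ideal_incl; split=> //; exists j.
    apply: gen_idealD; first exact: gen_idealM.
    by rewrite -scaleNr; apply: decomposableZ.
  - case: ifP => [hX'|_]; last by rewrite scale0r subr0; apply: gen_ideal0.
    have [/(_ _ hX')[_ hh'] _ _] := XP k.
    have [->|h0] := eqVneq (h i) 0; first by rewrite scaler0 subr0; apply: gen_ideal0.
    by move: jk; rewrite (dhomog_uniq h0 hh hh') ltnn.
  rewrite -jk hj subnn.
  suff -> : pihomog mdeg 0 (a i) = ((pihomog mdeg 0 (a i))@_0%MM)%:MP.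
    by rewrite mcoeffC eqxx mulr1 mul_mpolyC subrr; apply: gen_ideal0.
  apply/mpolyP => u; rewrite mcoeffC; case: eqVneq => [<-|u0]; first by rewrite mulr1.
  rewrite mulr0; apply: (dhomog_nemf_coeff (pihomogP _ _ _)).
  by rewrite mdeg_eq0.
have dec : decomposable k (g - \sum_(i < m) b i *: h i).
  rewrite -{1}(pihomog_dE hg) gE raddf_sum -sumrB.
  by apply: gen_ideal_sum => i; apply: part.
(* Repetitions among the [h i] are collected, as independence needs one
   coefficient for each vector. *)
pose c x := (x == g)%:R - \sum_(i < m | h i == x) b i.
suff /iX/(_ g gX)/eqP : decomposable k (\sum_(x <- X k) c x *: x).
  rewrite /c eqxx big_pred0 ?subr0 ?oner_eq0 // => i.
  by apply/negP => /eqP hig; apply: nG'g; rewrite -hig.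
suff -> : \sum_(x <- X k) c x *: x = g - \sum_(i < m) b i *: h i by [].
rewrite /c; under eq_bigr => x _ do rewrite scalerBl.
rewrite sumrB; congr (_ - _).
  rewrite (bigD1_seq g) //= eqxx scale1r big1 ?addr0 // => x /negPf ->.
  by rewrite scale0r.
under eq_bigr => x _ do rewrite scaler_suml big_mkcond.
rewrite exchange_big /=; apply: eq_bigr => i _; rewrite -big_mkcond /=.
have [hi|hi] := boolP (h i \in X k); last first.
  rewrite /b (negPf hi) scale0r big_seq_cond big_pred0 // => x.
  by apply/negP => /andP[xX /eqP hx]; rewrite hx xX in hi.
rewrite (big_rem (h i)) //= eqxx big_seq_cond big_pred0 ?addr0 // => x.
rewrite mem_rem_uniq // inE /=; case: (x =P h i) => [->|ne] //=.
by apply/andP => -[_ /eqP hx]; apply: ne.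
Qed.

End MinimalGenerators.

(** * Maximal chains of ideals *)

Section MaximalChains.
Local Open Scope order_scope.
Context {d : Order.disp_t} {P : finPOrderType d}.
Implicit Types (C : {set ideals P}) (X Y Z : ideals P).

Lemma ideals_leE X Y : (X <= Y) = ((X : {set P}) \subset Y).
Proof. by []. Qed.

Lemma is_chainP C :
  reflect (forall X Y, X \in C -> Y \in C -> X >=< Y) (is_chain C).
Proof.
by apply: (iffP forall_inP) => [h X Y /h/forall_inP h' /h'|h X XC] //;
  apply/forall_inP => Y; apply: h.
Qed.

Lemma chain_card_le C X Y : is_chain C -> X \in C -> Y \in C ->
  (#|(X : {set P})| <= #|(Y : {set P})|)%N -> X <= Y.
Proof.
move=> /is_chainP cC XC YC leXY; case/orP: (cC X Y XC YC) => // YX.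
by rewrite ideals_leE; have /eqP -> : (Y : {set P}) == X by rewrite eqEcard -ideals_leE YX.
Qed.

Lemma chain_card_inj C X Y : is_chain C -> X \in C -> Y \in C ->
  #|(X : {set P})| = #|(Y : {set P})| -> X = Y.
Proof.
by move=> cC XC YC e; apply: le_anti; rewrite !(chain_card_le cC) // e.
Qed.

Lemma max_chain_mem C Z : maxset (@is_chain _ (ideals P)) C ->
  (forall X, X \in C -> Z >=< X) -> Z \in C.
Proof.
move=> /maxsetP[/is_chainP cC mC] cZ; rewrite -(mC (Z |: C)) ?setU11 ?subsetUr //.
apply/is_chainP => X Y; rewrite !inE => /predU1P[->|XC] /predU1P[->|YC] //.
- by rewrite comparablexx.
- exact: cZ.
- by rewrite comparable_sym cZ.
- exact: cC.
Qed.

Fact full_ideal_subproof : is_ideal [set: P].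
Proof. by apply/is_idealP => x y; rewrite !inE. Qed.

Fact empty_ideal_subproof : is_ideal (set0 : {set P}).
Proof. by apply/is_idealP => x y; rewrite inE. Qed.

(** A maximal chain of ideals has no gap: between an ideal [X] of the chain and
    the next one [Y], adding to [X] a minimal element of [Y] outside [X] gives
    an ideal comparable with the whole chain. *)
Lemma max_chain_has_card C s : maxset (@is_chain _ (ideals P)) C ->
  (s <= #|P|)%N -> exists2 X, X \in C & #|(X : {set P})| = s.
Proof.
move=> mC le_s; have cC := maxsetp mC.
have C0 : Ideals empty_ideal_subproof \in C.
  by apply: (max_chain_mem mC) => X _; rewrite /Order.comparable ideals_leE sub0set.
have C1 : Ideals full_ideal_subproof \in C.
  by apply: (max_chain_mem mC) => X _; rewrite /Order.comparable !ideals_leE subsetT orbT.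
pose small X := (X \in C) && (#|(X : {set P})| <= s)%N.
have small0 : small (Ideals empty_ideal_subproof) by rewrite /small C0 cards0.
case: (arg_maxnP (fun X => #|(X : {set P})|) small0) => X /andP[XC leXs] maxX.
exists X => //; apply/eqP; rewrite eqn_leq leXs /= leqNgt; apply/negP => ltXs.
pose big Y := (Y \in C) && (#|(X : {set P})| < #|(Y : {set P})|)%N.
have big1 : big (Ideals full_ideal_subproof).
  by rewrite /big C1 cardsT; apply: leq_trans le_s.
case: (arg_minnP (fun Y => #|(Y : {set P})|) big1) => Y /andP[YC ltXY] minY.
have XY : X <= Y by apply: (chain_card_le cC) => //; apply: ltnW.
have /set0Pn[p0 p0YX] : (Y : {set P}) :\: X != set0.
  by rewrite setD_eq0; apply: contraL ltXY => /subset_leq_card; rewrite -leqNgt.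
case: (arg_minnP (fun p => #|[set q | q <= p]|) p0YX) => p /setDP[pY pX] minp.
have idZ : is_ideal (p |: (X : {set P})).
  apply/is_idealP => x y; rewrite !inE => /predU1P[->|xX] yx; last first.
    by rewrite (ideal_closed xX yx) orbT.
  case: eqVneq => //= nyp; apply: contraT => nyX.
  have /minp : y \in (Y : {set P}) :\: X by rewrite inE nyX (ideal_closed pY).
  rewrite leqNgt proper_card //; apply/properP; split.
    by apply/subsetP => z; rewrite !inE => /le_trans; apply.
  by exists p; rewrite !inE ?lexx // lt_geF // lt_neqAle nyp.
have ZC : Ideals idZ \in C.
  apply: (max_chain_mem mC) => W WC.
  have [leWX|ltXW] := leqP #|(W : {set P})| #|(X : {set P})|.
    rewrite comparable_sym /Order.comparable; apply/orP; left.
    by apply: le_trans (chain_card_le cC WC XC leWX) _; rewrite ideals_leE subsetUr.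
  apply/orP; left; have YW : Y <= W.
    by apply: (chain_card_le cC) => //; apply: minY; rewrite /big WC.
  by apply: le_trans YW; rewrite ideals_leE subUset sub1set pY.
have /maxX : small (Ideals idZ) by rewrite /small ZC cardsU1 pX.
by rewrite /= cardsU1 pX ltnn.
Qed.

(** Comparable ideals of the same size are equal, so a chain that meets every size
    cannot be extended. *)
Lemma chain_maximal C : is_chain C ->
    (forall s, (s <= #|P|)%N -> exists2 X, X \in C & #|(X : {set P})| = s) ->
  maxset (@is_chain _ (ideals P)) C.
Proof.
move=> cC cardC; apply/maxsetP; split=> // B cB CB.
apply/eqP; rewrite eqEsubset CB andbT; apply/subsetP => X XB.
have [Y YC eqc] := cardC _ (max_card (X : {set P})).
by rewrite -(chain_card_inj cB (subsetP CB Y YC) XB eqc).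
Qed.

End MaximalChains.

(** * The Boolean interval of an antichain *)

Section Cube.
Local Open Scope order_scope.
Context {d : Order.disp_t} {P : finPOrderType d} {q : nat} (a : 'I_q -> P).
Hypothesis a_anti : forall i j, a i <= a j -> i = j.
Implicit Types (B : {set 'I_q}).

(** The order embedding of the subsets of the antichain [a] into the ideals, with
    bottom the elements strictly below the antichain. *)
Definition cube_set B : {set P} :=
  [set x | [exists i, x < a i]] :|: [set a i | i in B].

Fact cube_subproof B : is_ideal (cube_set B).
Proof.
apply/is_idealP => x y; rewrite !inE => /orP[/existsP[i xi]|/imsetP[i iB ->]] yx.
  by apply/orP; left; apply/existsP; exists i; apply: le_lt_trans xi.
move: yx; rewrite le_eqVlt => /predU1P[->|yi]; first by rewrite imset_f ?orbT.
by apply/orP; left; apply/existsP; exists i.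
Qed.

Definition cube B : ideals P := Ideals (cube_subproof B).

Lemma cube_base_antichain i : [exists j, a i < a j] = false.
Proof.
apply/existsP => -[j ij]; have eij := a_anti (ltW ij).
by rewrite eij ltxx in ij.
Qed.

Lemma cube_gen_inj : injective a.
Proof. by move=> i j e; apply: a_anti; rewrite e. Qed.

Lemma mem_cube i B : (a i \in (cube B : {set P})) = (i \in B).
Proof. by rewrite !inE cube_base_antichain (mem_imset _ _ cube_gen_inj). Qed.

Lemma le_cube B B' : (cube B <= cube B') = (B \subset B').
Proof.
rewrite ideals_leE; apply/idP/idP => [/subsetP h|h]; last exact/setUS/imsetS.
by apply/subsetP => i; rewrite -!mem_cube; apply: h.
Qed.

Lemma cube_inj : injective cube.
Proof.
by move=> B B' e; apply/eqP; rewrite eqEsubset -!le_cube e lexx.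
Qed.

Lemma card_cube B :
  #|(cube B : {set P})| = (#|(cube set0 : {set P})| + #|B|)%N.
Proof.
rewrite /= /cube_set imset0 setU0 cardsU (card_imset _ cube_gen_inj).
rewrite [_ :&: _](_ : _ = set0) ?cards0 ?subn0 //.
apply/setP => x; rewrite !inE; apply/negP => /andP[+ /imsetP[i _ xi]].
by rewrite xi cube_base_antichain.
Qed.

End Cube.

(** * Cyclic intervals *)

Section CyclicIntervals.
Local Open Scope ring_scope.
Context {p : nat}.
Local Notation q := p.+3.
Implicit Types (i j m : 'I_q).

Definition cyclic_interval i (k : nat) : {set 'I_q} := [set m | ((m - i)%R < k)%N].

Lemma val_ord_sub i j : val (i - j) = (if (j <= i)%N then i - j else i + q - j)%N.
Proof.
rewrite /= modnDmr; have := ltn_ord i; have := ltn_ord j.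
case: (leqP j i) => ij jq iq.
  by rewrite addnBA ?(ltnW jq) // -addnBAC // modnDr modn_small //; lia.
by rewrite addnBA ?(ltnW jq) // modn_small; lia.
Qed.

Lemma card_cyclic_interval i k : (k <= q)%N -> #|cyclic_interval i k| = k.
Proof.
move=> kq; have -> : cyclic_interval i k = [set widen_ord kq t + i | t : 'I_k].
  apply/setP => m; rewrite inE; apply/idP/imsetP => [lt_k|[t _ ->]].
    exists (Ordinal lt_k) => //; rewrite -[LHS](subrK i); congr (_ + _).
    exact: val_inj.
  by rewrite addrK /=.
by rewrite card_imset ?card_ord // => s t /addIr/(congr1 val) /= /val_inj.
Qed.

Lemma val_ord1 : val (1 : 'I_q) = 1%N. Proof. by []. Qed.

(** The element just after the larger interval bounds the start of the smaller
    one, and the start of the smaller one has to be in the larger one; the bound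
    [k.+1 < q] excludes wrapping around the whole cycle. *)
Lemma cyclic_interval_subS i j k : (0 < k)%N -> (k.+1 < q)%N ->
    cyclic_interval i k \subset cyclic_interval j k.+1 ->
  j = i \/ j = i - 1.
Proof.
move=> k0 kq /subsetP sub.
have /sub : i \in cyclic_interval i k by rewrite inE subrr.
rewrite inE => ki.
have nj : j + inord k.+1 \notin cyclic_interval j k.+1.
  by rewrite inE addrC addKr inordK // ltnn.
have : j + inord k.+1 \notin cyclic_interval i k.
  by apply: contra nj; apply: sub.
rewrite inE -leqNgt [j + _ - i](_ : _ = inord k.+1 - (i - j)); last first.
  by rewrite opprB addrCA addrA.
rewrite val_ord_sub inordK //; move eD: (i - j) ki => D ki; rewrite ifT; last by lia.
move=> h; have : (D = 0 :> nat \/ D = 1 :> nat)%N by lia.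
case=> e; [left|right].
  by apply/eqP; rewrite eq_sym -subr_eq0 eD; apply/eqP/val_inj.
have -> : 1 = i - j by rewrite eD; apply: val_inj.
by rewrite opprB addrC subrK.
Qed.

(** The start of a proper interval is its only element whose predecessor is
    outside. *)
Lemma cyclic_interval_inj i j k : (0 < k)%N -> (k < q)%N ->
  cyclic_interval i k = cyclic_interval j k -> i = j.
Proof.
move=> k0 kq E; apply/eqP; apply: contraT => nij.
have : i \in cyclic_interval j k by rewrite -E inE subrr.
rewrite inE => lt_ij; have : i - 1 \in cyclic_interval j k.
  rewrite inE addrAC; move eD: (i - j) lt_ij => D lt_ij.
  have D0 : (0 < D)%N.
    rewrite lt0n; apply: contra nij => /eqP e.
    by rewrite -subr_eq0 eD; apply/eqP/val_inj.
  by rewrite val_ord_sub val_ord1 ifT; lia.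
rewrite -E inE addrC addKr -[X in val X]sub0r val_ord_sub val_ord1 /=; lia.
Qed.

End CyclicIntervals.

(** * Rotating maximal chains *)

Section CyclicChains.
Local Open Scope ring_scope.
Context {d : Order.disp_t} {P : finPOrderType d} {p : nat}.
Local Notation q := p.+3.
Context (a : 'I_q -> P) (a_anti : forall i j, (a i <= a j)%O -> i = j).
Context (M : {set ideals P}) (maxM : maxset (@is_chain _ (ideals P)) M)
  (botM : cube a set0 \in M) (topM : cube a setT \in M).
Implicit Types (i j : 'I_q) (X : ideals P) (b : bool) (k : nat).

Definition outer : {set ideals P} :=
  [set X in M | (X <= cube a set0)%O || (cube a setT <= X)%O].

(** The two families of chains differ by moving the start back by one from length
    2 on; at length 1 they agree. *)
Definition shift b k : 'I_q := if b && (1 < k)%N then 1 else 0.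

Definition interval_ideal j k : ideals P := cube a (cyclic_interval j k).

Definition cyclic_chain b i : {set ideals P} :=
  outer :|: [set interval_ideal (i - shift b k) k | k : 'I_q & (0 < k)%N].

Lemma card_interval_ideal j k : (k <= q)%N ->
  #|(interval_ideal j k : {set P})| = (#|(cube a set0 : {set P})| + k)%N.
Proof.
move=> kq; rewrite {1}/interval_ideal [LHS](card_cube a_anti).
by rewrite card_cyclic_interval.
Qed.

Lemma interval_ideal_outer j k : (0 < k < q)%N -> interval_ideal j k \notin outer.
Proof.
move=> /andP[k0 kq]; rewrite inE /interval_ideal !(le_cube a_anti) negb_and negb_or.
apply/orP; right; apply/andP; split; apply/negP => /subset_leq_card.
  by rewrite cards0 card_cyclic_interval ?(ltnW kq) // leqNgt k0.
by rewrite cardsT card_ord card_cyclic_interval ?(ltnW kq) // leqNgt kq.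
Qed.

Lemma mem_cyclic_chain b i j k : (0 < k < q)%N ->
  (interval_ideal j k \in cyclic_chain b i) = (j == i - shift b k).
Proof.
move=> kP; have /andP[k0 kq] := kP.
rewrite inE (negPf (interval_ideal_outer _ kP)) /=.
apply/imsetP/eqP => [[k']|->]; last by exists (Ordinal kq); rewrite ?inE.
rewrite inE => k'0 e; have := congr1 (fun X : ideals P => #|(X : {set P})|) e.
rewrite !card_interval_ideal ?(ltnW kq) ?(ltnW (ltn_ord _)) // => /addnI ek.
by move: e; rewrite -ek => /(cube_inj a_anti)/(cyclic_interval_inj k0 kq).
Qed.

Lemma shifted_interval_sub b i k k' : (0 < k <= k')%N ->
  cyclic_interval (i - shift b k) k \subset cyclic_interval (i - shift b k') k'.
Proof.
move=> /andP[k0 kk']; apply/subsetP => m; rewrite !inE.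
have [->|] := eqVneq (shift b k) (shift b k').
  by move=> h; apply: leq_trans h kk'.
rewrite /shift; case: b; [rewrite !andTb | by rewrite eqxx]; have [h|h] := boolP (1 < k)%N.
  by rewrite (leq_trans h kk') eqxx.
have {h} -> : k = 1%N by lia.
case: ifP => [h _|]; last by rewrite eqxx.
rewrite subr0 ltnS leqn0 => /eqP e; have -> : m = i.
  by apply/eqP; rewrite -subr_eq0; apply/eqP/val_inj.
by rewrite opprB addrC subrK val_ord1.
Qed.

Lemma cyclic_chainP b i X :
  reflect (X \in outer \/ exists2 k, (0 < k < q)%N & X = interval_ideal (i - shift b k) k)
    (X \in cyclic_chain b i).
Proof.
rewrite in_setU; apply: (iffP orP) => -[XO|h]; [by left | right | by left | right].
  by case/imsetP: h => k; rewrite inE => k0 ->; exists k; rewrite ?k0 ?ltn_ord.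
by case: h => k /andP[k0 kq] ->; apply/imsetP; exists (Ordinal kq); rewrite ?inE.
Qed.

Lemma cyclic_chain_is_chain b i : is_chain (cyclic_chain b i).
Proof.
have /is_chainP cM := maxsetp maxM.
have outer_cube X B : X \in outer -> (X >=< cube a B)%O.
  rewrite inE => /andP[_ /orP[h|h]]; rewrite /Order.comparable; apply/orP.
    by left; apply: le_trans h _; rewrite (le_cube a_anti) sub0set.
  by right; apply: le_trans _ h; rewrite (le_cube a_anti) subsetT.
apply/is_chainP => X Y /cyclic_chainP[XO|[k kP ->]] /cyclic_chainP[YO|[k' kP' ->]].
- by apply: cM; [case/setIdP: XO | case/setIdP: YO].
- exact: outer_cube.
- by rewrite comparable_sym; apply: outer_cube.
wlog kk' : k k' kP kP' / (k <= k')%N => [wl|].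
  by case/orP: (leq_total k k') => h; [|rewrite comparable_sym]; apply: wl.
apply/orP; left; rewrite (le_cube a_anti); apply: shifted_interval_sub.
by rewrite kk' andbT; case/andP: kP.
Qed.

(** The sizes below and above the cube are provided by the maximal chain [M], the
    intermediate ones by the intervals. *)
Lemma cyclic_chain_max b i : maxset (@is_chain _ (ideals P)) (cyclic_chain b i).
Proof.
apply: chain_maximal; first exact: cyclic_chain_is_chain.
have cM := maxsetp maxM.
move=> s sP; have [X XM eX] := max_chain_has_card maxM sP.
have eT : #|(cube a setT : {set P})| = (#|(cube a set0 : {set P})| + q)%N.
  by rewrite (card_cube a_anti) cardsT card_ord.
have [s_lo|s_lo] := leqP s #|(cube a set0 : {set P})|.
  exists X => //; apply/cyclic_chainP; left; rewrite inE XM /=.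
  by apply/orP; left; apply: (chain_card_le cM); rewrite // eX.
have [s_hi|s_hi] := leqP (#|(cube a set0 : {set P})| + q) s.
  exists X => //; apply/cyclic_chainP; left; rewrite inE XM /=.
  by apply/orP; right; apply: (chain_card_le cM); rewrite // eT eX.
set k := (s - #|(cube a set0 : {set P})|)%N.
have kP : (0 < k < q)%N by apply/andP; split; rewrite /k; lia.
exists (interval_ideal (i - shift b k) k).
  by rewrite mem_cyclic_chain.
by rewrite card_interval_ideal /k; lia.
Qed.

Definition cyclic_max_chain b i : max_chain (ideals P) :=
  MaxChain (cyclic_chain_max b i).

Lemma mem_cyclic_max_chain b i j k : (0 < k < q)%N ->
  (interval_ideal j k \in (cyclic_max_chain b i : {set ideals P})) = (j == i - shift b k).
Proof. exact: mem_cyclic_chain. Qed.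

Lemma cyclic_max_chain_inj b : injective (cyclic_max_chain b).
Proof.
move=> i j e; have := mem_cyclic_max_chain b i i (isT : 0 < 1 < q)%N.
by rewrite e mem_cyclic_max_chain // /shift andbF !subr0 eqxx => /eqP.
Qed.

(** Length 1 forces [i = j], and length 2 then separates the two chains. *)
Lemma cyclic_max_chain_twist i j : cyclic_max_chain true i != cyclic_max_chain false j.
Proof.
apply/eqP => e; have := mem_cyclic_max_chain true i i (isT : 0 < 1 < q)%N.
rewrite e mem_cyclic_max_chain // /shift /= !subr0 eqxx => /eqP ij.
have := mem_cyclic_max_chain true i (i - 1) (isT : 0 < 2 < q)%N.
rewrite e mem_cyclic_max_chain // /shift /= -ij subr0 eqxx => /eqP.
by move/(congr1 (fun x => i - x)); rewrite subKr subrr.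
Qed.

(** At a fixed length the twist only permutes the starts. *)
Lemma cyclic_chain_cover X :
  #|[set i | X \in cyclic_chain true i]| = #|[set i | X \in cyclic_chain false i]|.
Proof.
case: (classic (exists j k, (0 < k < q)%N /\ X = interval_ideal j k)) => [[j [k [kP ->]]]|nX].
  have card1 b : #|[set i | interval_ideal j k \in cyclic_chain b i]| = 1%N.
    rewrite -[RHS](cards1 (j + shift b k)); apply: eq_card => i.
    by rewrite in_set1 in_set mem_cyclic_chain // eq_sym subr_eq.
  by rewrite !card1.
apply: eq_card => i; rewrite !inE; congr (_ || _).
have nO b : (X \in [set interval_ideal (i - shift b k) k | k : 'I_q & (0 < k)%N]) = false.
  apply/imsetP => -[k]; rewrite inE => k0 e; apply: nX.
  by exists (i - shift b k), k; rewrite k0 ltn_ord.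
by rewrite !nO.
Qed.

Definition content (w : max_chain (ideals P) -> nat) X : nat :=
  (\sum_(C : max_chain (ideals P) | X \in (C : {set _})) w C)%N.

(** In this section, [w] is a family of distinct chains C_i, and [w'] is any family
    of maximal chains with the same content. *)
Section UniqueFibre.
Context (w w' : max_chain (ideals P) -> nat).
Local Notation C := (cyclic_max_chain false).
Hypotheses (w_le1 : forall D, (w D <= 1)%N)
  (w_supp : forall D, (0 < w D)%N -> exists i, D = C i)
  (content_eq : content w =1 content w').

Lemma content_pos (v : max_chain (ideals P) -> nat) X : (0 < content v X)%N ->
  exists2 D : max_chain (ideals P), (0 < v D)%N & X \in (D : {set _}).
Proof.
rewrite lt0n sum_nat_eq0 negb_forall => /existsP[D]; rewrite negb_imply -lt0n.
by case/andP; exists D.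
Qed.

Lemma content_ge (v : max_chain (ideals P) -> nat) (D : max_chain (ideals P)) X :
  X \in (D : {set _}) -> (v D <= content v X)%N.
Proof. by move=> XD; rewrite /content (bigD1 D) //= leq_addr. Qed.

Lemma content_interval i k : (0 < k < q)%N -> content w (interval_ideal i k) = w (C i).
Proof.
move=> kP; rewrite /content (bigD1 (C i)) /=; last first.
  by rewrite mem_cyclic_chain // /shift subr0.
rewrite big1 ?addn0 // => D /andP[iD nD]; apply/eqP; rewrite -leqn0 leqNgt.
apply/negP => /w_supp[j eD]; case/eqP: nD; rewrite eD; congr (C _).
by move: iD; rewrite eD mem_cyclic_max_chain // /shift subr0 => /eqP.
Qed.

Lemma supp_mem (D : max_chain (ideals P)) X : (0 < w' D)%N -> X \in (D : {set _}) ->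
  X \in outer \/ exists i k, [/\ (0 < k < q)%N, X = interval_ideal i k & (0 < w (C i))%N].
Proof.
move=> wD XD; have : (0 < content w X)%N.
  by rewrite content_eq; apply: leq_trans wD (content_ge _ XD).
case/content_pos => _ /[dup]/w_supp[i ->] wi /cyclic_chainP[|[k kP ->]]; first by left.
by right; exists i, k; rewrite /shift subr0.
Qed.

(** The content of [w'] at an interval is at most 1. *)
Lemma interval_chain_uniq (D D' : max_chain (ideals P)) i k : (0 < k < q)%N ->
  (0 < w' D)%N -> (0 < w' D')%N -> interval_ideal i k \in (D : {set _}) ->
  interval_ideal i k \in (D' : {set _}) -> D = D'.
Proof.
move=> kP wD wD' iD iD'; apply/eqP; apply: contraT => nDD'.
have := w_le1 (C i); rewrite -(content_interval i kP) content_eq /content.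
rewrite (bigD1 D) //= (bigD1 D') /=; last by rewrite iD' eq_sym.
lia.
Qed.

Context (j0 : 'I_q) (w_j0 : w (C j0) = 0%N).

(** The induction goes around the cycle from the missing index [j0].  If the chain
    [D] moved from start [i] to start [i - 1], the chain through the interval of
    length [k] and start [i - 1] would by induction keep its start, hence would
    coincide with [D], which would then contain two intervals of length [k]. *)
Lemma chain_step (D : max_chain (ideals P)) i k : (0 < w' D)%N -> (0 < k)%N ->
    (k.+1 < q)%N -> interval_ideal i k \in (D : {set _}) ->
  interval_ideal i k.+1 \in (D : {set _}).
Proof.
move=> + k0 kq; have [r] := ubnP (val (i - j0)).
elim: r => // r IHr in i D * => lt_r wD iD.
have kP : (0 < k < q)%N by rewrite k0 ltnW.
have kP1 : (0 < k.+1 < q)%N by [].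
have wi : (0 < w (C i))%N.
  by rewrite -(content_interval i kP) content_eq; apply: leq_trans wD (content_ge _ iD).
have cD := maxsetp (valP D).
have [Y YD eY] : exists2 Y : ideals P, Y \in (D : {set _}) & 
    #|(Y : {set P})| = (#|(cube a set0 : {set P})| + k.+1)%N.
  apply: (max_chain_has_card (valP D)); rewrite -(card_interval_ideal i (ltnW kq)).
  exact: max_card.
have [YO|[j [k' [kP' eYj wj]]]] := supp_mem wD YD.
  move: YO; rewrite inE => /andP[_ /orP[]] /subset_leq_card; rewrite eY; first lia.
  by rewrite (card_cube a_anti) cardsT card_ord; lia.
have ek : k' = k.+1.
  by move: eY; rewrite eYj card_interval_ideal; lia.
have : (interval_ideal i k <= interval_ideal j k.+1)%O.
  rewrite -ek -eYj; apply: (chain_card_le cD) => //.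
  by rewrite eY card_interval_ideal ?(ltnW (ltnW kq)) //; lia.
rewrite (le_cube a_anti) => /(cyclic_interval_subS k0 kq) [ji|ji].
  by rewrite -ji -ek -eYj.
have [D' wD' jD'] : exists2 D' : max_chain (ideals P),
    (0 < w' D')%N & interval_ideal j k \in (D' : {set _}).
  by apply: content_pos; rewrite -content_eq content_interval.
have ij0 : i - j0 != 0.
  by rewrite subr_eq0; apply: contraTneq wi => ->; rewrite w_j0.
have jD'1 : interval_ideal j k.+1 \in (D' : {set _}).
  apply: IHr => //; rewrite ji addrAC; move: (i - j0) ij0 lt_r => D0 D0n lt_r.
  have : (0 < D0)%N by rewrite lt0n; apply: contra D0n => /eqP e; apply/eqP/val_inj.
  move=> h; have := (lt_r : (nat_of_ord D0 < r.+1)%N).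
  by rewrite val_ord_sub val_ord1 ifT; lia.
have eDD' : D' = D by apply: (interval_chain_uniq kP1) jD'1 _ => //; rewrite -ek -eYj.
rewrite eDD' in jD'; have : interval_ideal i k = interval_ideal j k.
  by apply: (chain_card_inj cD) => //; rewrite !card_interval_ideal ?(ltnW (ltnW kq)).
move/(cube_inj a_anti)/(cyclic_interval_inj k0 (ltnW kq)) => ij.
by move: eYj; rewrite -ij ek => <-.
Qed.

(** Starting from its interval of length 1, a chain of [w'] keeps its start at
    all lengths; outside the cube it can only use the common part of the C_i. *)
Lemma fibre_supp (D : max_chain (ideals P)) : (0 < w' D)%N -> exists i, D = C i.
Proof.
move=> wD; have cD := maxsetp (valP D).
have [Y YD eY] : exists2 Y : ideals P, Y \in (D : {set _}) & 
    #|(Y : {set P})| = (#|(cube a set0 : {set P})| + 1)%N.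
  apply: (max_chain_has_card (valP D)); rewrite -(@card_interval_ideal 0 1 isT).
  exact: max_card.
have [YO|[i [k [kP eYi wi]]]] := supp_mem wD YD.
  move: YO; rewrite inE => /andP[_ /orP[]] /subset_leq_card; rewrite eY; first lia.
  by rewrite (card_cube a_anti) cardsT card_ord; lia.
have ek : k = 1%N by move: eY; rewrite eYi card_interval_ideal; lia.
rewrite {k}ek in kP eYi; rewrite {Y}eYi in YD eY.
have intervalD : forall k, (0 < k < q)%N -> interval_ideal i k \in (D : {set _}).
  elim=> // -[_ //|k IHk] /andP[_ kq]; apply: chain_step => //.
  by apply: IHk; rewrite /= ltnW.
exists i; apply/val_inj/esym; case/maxsetP: (valP D) => _; apply.
  exact: cyclic_chain_is_chain.
apply/subsetP => X XD; apply/cyclic_chainP.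
have [|[j [k [kP' eX wj]]]] := supp_mem wD XD; first by left.
right; exists k => //; rewrite /shift subr0.
apply: (chain_card_inj cD) => //; first exact: intervalD.
by rewrite eX !card_interval_ideal //; lia.
Qed.

Lemma unique_fibre : w' =1 w.
Proof.
have main i : w' (C i) = w (C i).
  have kP : (0 < 1 < q)%N by [].
  rewrite -(content_interval i kP) content_eq /content (bigD1 (C i)) /=; last first.
    by rewrite mem_cyclic_chain // /shift subr0.
  rewrite big1 ?addn0 // => D /andP[iD nD]; apply/eqP; rewrite -leqn0 leqNgt.
  apply/negP => /fibre_supp[j eD]; case/eqP: nD; rewrite eD; congr (C _).
  by move: iD; rewrite eD mem_cyclic_max_chain // /shift subr0 => /eqP.
move=> D; have [wD|] := ltnP 0 (w D); first by have [i ->] := w_supp wD.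
have [wD|] := ltnP 0 (w' D); first by have [i ->] := fibre_supp wD.
by rewrite !leqn0 => /eqP -> /eqP ->.
Qed.

End UniqueFibre.
End CyclicChains.

(** * The presentation of the chain algebra on coefficients *)

Section ChainMap.
Local Open Scope ring_scope.
Context (K : fieldType) {d : Order.disp_t} {L : finPOrderType d}.
Implicit Types (m : 'X_{1..#|{: max_chain L}|}) (f : {mpoly K[#|{: max_chain L}|]}).

Definition chain_exponent m : 'X_{1..#|L|} :=
  [multinom (\sum_(C : max_chain L | enum_val x \in (C : {set L})) m (enum_rank C))%N
    | x < #|L|].

Lemma chain_mapXE m : chain_map 'X_[K, m] = 'X_[chain_exponent m].
Proof.
rewrite /chain_map comp_mpolyX.
pose e (C : max_chain L) : 'X_{1..#|L|} := (\sum_(x in (C : {set L})) U_(enum_rank x))%MM.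
have monE C : chain_monomial K C = 'X_[e C].
  by rewrite /chain_monomial /e (big_morph _ (@mpolyXD _ K) (mpolyX0 _ K)).
under eq_bigr => i _ do rewrite tnth_mktuple monE mpolyXn.
rewrite -(big_morph _ (@mpolyXD _ K) (mpolyX0 _ K)); congr 'X_[_].
apply/mnmP => x; rewrite mnmE mnm_sumE.
rewrite (reindex (@enum_rank {: max_chain L})) /=; last exact/onW_bij/enum_rank_bij.
rewrite [RHS]big_mkcond /=; apply: eq_bigr => C _.
rewrite mulmnE enum_rankK /e mnm_sumE.
have eqx y : U_(enum_rank y)%MM x = (y == enum_val x) :> nat.
  by rewrite mnm1E -(can_eq enum_valK) enum_rankK.
under eq_bigr => y _ do rewrite eqx.
case: ifP => xC; last first.
  rewrite big1 ?mul0n // => y yC; case: eqP => // yx.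
  by rewrite -yx yC in xC.
rewrite (bigD1 (enum_val x)) //= eqxx big1 ?mul1n // => y /andP[_ /negPf -> //].
Qed.

Lemma mcoeff_chain_map f u :
  (chain_map f)@_u = \sum_(m <- msupp f) f@_m * (chain_exponent m == u)%:R.
Proof.
rewrite /chain_map comp_mpolyEX raddf_sum /=; apply: eq_bigr => m _.
by rewrite mcoeffZ -/(chain_map _) chain_mapXE mcoeffX.
Qed.

(** A monomial alone in its fibre cannot be cancelled. *)
Lemma mcoeff_chain_map_inj f m0 :
    (forall m, chain_exponent m = chain_exponent m0 -> m = m0) ->
  (chain_map f)@_(chain_exponent m0) = f@_m0.
Proof.
move=> inj; rewrite mcoeff_chain_map.
have eqm m : (chain_exponent m == chain_exponent m0) = (m == m0).
  by apply/eqP/eqP => [/inj|->].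
under eq_bigr => m _ do rewrite eqm.
have [m0f|m0f] := boolP (m0 \in msupp f).
  rewrite (bigD1_seq m0) //= eqxx mulr1 big1 ?addr0 // => m /negPf ->.
  by rewrite mulr0.
rewrite big_seq big1 ?(memN_msupp_eq0 m0f) // => m mf.
by case: eqP mf m0f => [-> ->|]; rewrite ?mulr0.
Qed.

Lemma chain_ideal0 : chain_defining_ideal (0 : {mpoly K[#|{: max_chain L}|]}).
Proof. exact: raddf0. Qed.

Lemma chain_idealD f g : chain_defining_ideal f -> chain_defining_ideal g ->
  chain_defining_ideal (f + g).
Proof.
rewrite /chain_defining_ideal /chain_map => f0 g0.
by rewrite comp_mpolyD f0 g0 addr0.
Qed.

Lemma chain_idealM f g : chain_defining_ideal g -> chain_defining_ideal (f * g).
Proof. by rewrite /chain_defining_ideal /chain_map rmorphM /= => ->; rewrite mulr0. Qed.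

End ChainMap.

Section DefiningIdeal.
Local Open Scope ring_scope.
Context (K : fieldType) {d : Order.disp_t} {P : finPOrderType d}.
Local Notation L := (ideals P).
Implicit Types (m : 'X_{1..#|{: max_chain L}|}) (f : {mpoly K[#|{: max_chain L}|]}).

(** This makes the chain map graded: each maximal chain contributes exactly one
    occurrence of the bottom element. *)
Lemma chain_exponent_bot m :
  chain_exponent m (enum_rank (Ideals empty_ideal_subproof)) = mdeg m.
Proof.
rewrite mnmE enum_rankK mdegE [RHS](reindex (@enum_rank {: max_chain L})) /=.
  apply: eq_bigl => C; apply: (max_chain_mem (valP C)) => X _.
  by rewrite /Order.comparable ideals_leE sub0set.
exact/onW_bij/enum_rank_bij.
Qed.

Lemma chain_ideal_homog e f :
  chain_defining_ideal f -> chain_defining_ideal (pihomog mdeg e f).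
Proof.
move=> f0; apply/mpolyP => u; rewrite mcoeff0.
(* The image of the degree-e part collects exactly the terms of the image of [f]
   with exponent [e] at the bottom element. *)
have -> : (chain_map (pihomog mdeg e f))@_u =
    \sum_(m <- msupp f | mdeg m == e) f@_m * (chain_exponent m == u)%:R.
  rewrite pihomogE /chain_map [_ \mPo _]raddf_sum [LHS]raddf_sum; apply: eq_bigr => m _.
  rewrite [LHS]/= comp_mpolyZ mcoeffZ -/(chain_map _).
  by rewrite chain_mapXE mcoeffX.
have [ue|ue] := eqVneq (u (enum_rank (Ideals empty_ideal_subproof))) e; last first.
  rewrite big1 // => m /eqP me; case: eqP => [mu|]; last by rewrite mulr0.
  by move: ue; rewrite -mu chain_exponent_bot me eqxx.
transitivity (chain_map f)@_u; last by rewrite f0 mcoeff0.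
rewrite mcoeff_chain_map big_mkcond /=; apply: eq_bigr => m _.
case: ifP => // /eqP me; case: eqP => [mu|]; last by rewrite mulr0.
by case: me; rewrite -ue -mu chain_exponent_bot.
Qed.

End DefiningIdeal.

(** * The indecomposable binomial *)

Section CyclicBinomial.
Local Open Scope ring_scope.
Context (K : fieldType) {d : Order.disp_t} {P : finPOrderType d} {p : nat}.
Local Notation q := p.+3.
Context (a : 'I_q -> P) (a_anti : forall i j, (a i <= a j)%O -> i = j).
Context (M : {set ideals P}) (maxM : maxset (@is_chain _ (ideals P)) M)
  (botM : cube a set0 \in M) (topM : cube a setT \in M).
Local Notation L := (ideals P).
Local Notation C := (cyclic_max_chain a_anti maxM botM topM).

Definition cyclic_exponent (b : bool) : 'X_{1..#|{: max_chain L}|} :=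
  (\sum_(i < q) U_(enum_rank (C b i)))%MM.

Lemma cyclic_exponentE b D : cyclic_exponent b (enum_rank D) = [exists i, D == C b i] :> nat.
Proof.
rewrite /cyclic_exponent mnm_sumE.
under eq_bigr => i _ do rewrite mnm1E (inj_eq enum_rank_inj).
case: existsP => [[i /eqP ->]|nD]; last first.
  by rewrite big1 // => i _; case: eqP => // e; case: nD; exists i; rewrite e.
rewrite (bigD1 i) //= eqxx big1 // => j ji.
by rewrite (inj_eq (@cyclic_max_chain_inj _ _ _ _ _ _ _ _ _ b)) (negPf ji).
Qed.

Lemma mdeg_cyclic_exponent b : mdeg (cyclic_exponent b) = q.
Proof.
rewrite /cyclic_exponent mdeg_sum; under eq_bigr => i _ do rewrite mdeg1.
by rewrite sum1_card card_ord.
Qed.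

Lemma cyclic_exponent_neq : cyclic_exponent true != cyclic_exponent false.
Proof.
apply/eqP => /mnmP/(_ (enum_rank (C true 0))); rewrite !cyclic_exponentE.
case: existsP => [_|[]]; last by exists 0.
by case: existsP => // -[j]; rewrite (negPf (cyclic_max_chain_twist _ _ _ _ _ _)).
Qed.

Lemma chain_exponent_cyclic b X :
  chain_exponent (cyclic_exponent b) (enum_rank X) = #|[set i | X \in cyclic_chain a M b i]|.
Proof.
rewrite mnmE enum_rankK.
under eq_bigr => D _ do rewrite /cyclic_exponent mnm_sumE.
rewrite exchange_big /= -[RHS]sum1_card [RHS]big_mkcond /=; apply: eq_bigr => i _.
rewrite in_set; under eq_bigr => D _ do rewrite mnm1E (inj_eq enum_rank_inj).
case: ifP => iX.
  by rewrite (bigD1 (C b i)) //= eqxx big1 // => D /andP[_ nD]; rewrite eq_sym (negPf nD).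
by rewrite big1 // => D XD; case: eqP => // e; rewrite -e /= iX in XD.
Qed.

Lemma cyclic_binomial_in_ideal :
  chain_defining_ideal ('X_[K, cyclic_exponent false] - 'X_[cyclic_exponent true]).
Proof.
rewrite /chain_defining_ideal /chain_map comp_mpolyB -!/(chain_map _) !chain_mapXE.
apply/eqP; rewrite subr_eq0; apply/eqP; congr 'X_[_]; apply/mnmP => x.
by rewrite -(enum_valK x) !chain_exponent_cyclic cyclic_chain_cover.
Qed.

(** A proper divisor misses some C_j, and this is where the cycle is cut. *)
Lemma chain_exponent_inj_below (m0 m : 'X_{1..#|{: max_chain L}|}) :
    (forall i, m0 i <= cyclic_exponent false i)%N -> m0 != cyclic_exponent false ->
  chain_exponent m = chain_exponent m0 -> m = m0.
Proof.
move=> le_m0 ne_m0 eq_m.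
have [j0 mj0] : exists j, m0 (enum_rank (C false j)) = 0%N.
  case: (classic (exists j, m0 (enum_rank (C false j)) = 0%N)) => // nj.
  case/eqP: ne_m0; apply/mnmP => x; apply/eqP; rewrite eqn_leq le_m0 /=.
  rewrite -(enum_valK x) cyclic_exponentE; case: existsP => // -[j /eqP ->].
  by rewrite lt0n; apply/eqP => e; apply: nj; exists j.
have le1 D : (m0 (enum_rank D) <= 1)%N.
  by apply: leq_trans (le_m0 _) _; rewrite cyclic_exponentE; case: existsP.
have supp D : (0 < m0 (enum_rank D))%N -> exists i, D = C false i.
  move=> h; have := leq_trans h (le_m0 _); rewrite cyclic_exponentE.
  by case: existsP => // -[i /eqP ->]; exists i.
have eqc : content (fun D => m0 (enum_rank D)) =1 content (fun D => m (enum_rank D)).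
  move=> X; have /mnmP/(_ (enum_rank X)) := eq_m.
  by rewrite !mnmE enum_rankK.
apply/mnmP => x; rewrite -(enum_valK x).
exact: (unique_fibre le1 supp eqc mj0).
Qed.

(** In a product [c i * h i] the coefficient at the first monomial of the binomial
    involves the coefficients of [h i] at its divisors.  The proper divisors are
    alone in their fibre, and the monomial itself has degree [q], which exceeds
    the degree of [h i]. *)
Lemma cyclic_binomial_indecomposable :
  ~ decomposable (@chain_defining_ideal K _ L) q
      ('X_[cyclic_exponent false] - 'X_[cyclic_exponent true]).
Proof.
move=> [r [c [h [hP /(congr1 (mcoeff (cyclic_exponent false)))]]]].
rewrite mcoeffB !mcoeffX eqxx (negPf cyclic_exponent_neq) subr0 raddf_sum /=.
rewrite big1 => [/eqP|i _]; first by rewrite oner_eq0.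
have [hI [e lt_e homh]] := hP i.
rewrite mcoeffM big1 // => k /eqP ek.
suff -> : (h i)@_(k.2) = 0 by rewrite mulr0.
have [k2|nk2] := eqVneq (k.2 : 'X_{1.._}) (cyclic_exponent false).
  apply: (dhomog_nemf_coeff homh); apply/eqP => ke.
  have eq_e : e = q by rewrite -(mdeg_cyclic_exponent false) -k2 -ke.
  by rewrite eq_e ltnn in lt_e.
rewrite -mcoeff_chain_map_inj ?hI ?mcoeff0 // => m; apply: chain_exponent_inj_below => //.
by move=> x; have /mnmP/(_ x) -> := ek; rewrite mnmDE leq_addl.
Qed.

End CyclicBinomial.

Lemma width_antichain (d : Order.disp_t) (P : finPOrderType d) (n : nat) :
    width P = n ->
  exists a : 'I_n -> P, forall i j, (a i <= a j)%O -> i = j.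
Proof.
have anti0 : is_antichain (set0 : {set P}) by apply/forall_inP => x; rewrite inE.
move=> <-; have [A antiA ->] : {A : {set P} | is_antichain A & width P = #|A|}.
  by apply: eq_bigmax_cond; apply/card_gt0P; exists set0.
exists enum_val => i j ij; apply: enum_val_inj.
have /forall_inP/(_ _ (enum_valP j))/implyP := forall_inP antiA _ (enum_valP i).
by move=> h; apply/eqP/h; rewrite /Order.comparable ij.
Qed.

Theorem corollary2p6 (K : fieldType) (d : Order.disp_t) (P : finPOrderType d)
    (n : nat) (width_P : width P = n) (n_gt2 : 2 < n) :
  has_minimal_generator_of_degree n (chain_defining_ideal (K := K) (L := ideals P)).
Proof.
case: n n_gt2 width_P => [|[|[|p]]] // _ /width_antichain[a a_anti].
have c01 : is_chain [set cube a set0; cube a setT].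
  apply/is_chainP => X Y; have c : (cube a set0 <= cube a setT)%O.
    by rewrite (le_cube a_anti) sub0set.
  by rewrite !inE => /orP[]/eqP-> /orP[]/eqP->;
    rewrite /Order.comparable ?lexx ?c ?orbT.
have [M maxM /subsetP subM] := maxset_exists c01.
have botM : cube a set0 \in M by apply: subM; rewrite !inE eqxx.
have topM : cube a setT \in M by apply: subM; rewrite !inE eqxx orbT.
have hom b : 'X_[K, cyclic_exponent a_anti maxM botM topM b] \is p.+3.-homog.
  by rewrite dhomogX; apply/eqP; apply: mdeg_cyclic_exponent.
apply: (minimal_generator_criterion _ _ _ _
  (cyclic_binomial_in_ideal K a_anti maxM botM topM)
  (rpredB (hom false) (hom true))
  (@cyclic_binomial_indecomposable K _ _ _ _ a_anti _ maxM botM topM)).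
- exact: chain_ideal0.
- by move=> f g; apply: chain_idealD.
- by move=> f g; apply: chain_idealM.
- by move=> e f; apply: chain_ideal_homog.
Qed.
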